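(* Let $X,Y$ be complex Banach spaces, let $c\in\mathbb{C}\setminus\{0\}$, let $\mathcal{B}$ be a non-empty collection of non-empty subsets of $X$ such that every $x\in X$ belongs to some $B\in\mathcal{B}$, let $l\in\mathbb{N}$, and let $\emptyset\neq I'\subseteq I\subseteq\mathbb{R}^n$ with $I+I'\subseteq I$. Suppose that $F:I\times X\to Y$ is Bohr $(\mathcal{B},I',c)$-almost periodic (respectively, $(\mathcal{B},I',c)$-uniformly recurrent). Then $lI'\subseteq I$, $I+lI'\subseteq I$, and $F$ is Bohr $(\mathcal{B},lI',c^{l})$-almost periodic (respectively, $(\mathcal{B},lI',c^{l})$-uniformly recurrent), where $lI':=\{l\mathbf{t}:\mathbf{t}\in I'\}$.
   Context: Here $n\in\mathbb{N}=\{1,2,\dots\}$, $|\cdot|$ is the Euclidean norm on $\mathbb{R}^n$ and $B(\mathbf{t}_0,r):=\{\mathbf{t}\in\mathbb{R}^n:|\mathbf{t}-\mathbf{t}_0|\le r\}$. Let $\emptyset\neq J\subseteq I\subseteq\mathbb{R}^n$ with $I+J\subseteq I$, let $d\in\mathbb{C}\setminus\{0\}$ and let $F:I\times X\to Y$ be continuous. $F$ is Bohr $(\mathcal{B},J,d)$-almost periodic if for every $B\in\mathcal{B}$ and $\epsilon>0$ there exists $r>0$ such that for each $\mathbf{t}_0\in J$ there exists $\tau\in B(\mathbf{t}_0,r)\cap J$ such that $\|F(\mathbf{t}+\tau;x)-dF(\mathbf{t};x)\|_Y\le\epsilon$ for all $\mathbf{t}\in I$, $x\in B$. $F$ is $(\mathcal{B},J,d)$-uniformly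 recurrent if for every $B\in\mathcal{B}$ there exists a sequence $(\tau_k)$ in $J$ such that $\lim_{k\to+\infty}|\tau_k|=+\infty$ and $\lim_{k\to+\infty}\sup_{\mathbf{t}\in I,\,x\in B}\|F(\mathbf{t}+\tau_k;x)-dF(\mathbf{t};x)\|_Y=0$. *)

(* Defs.v *)
From mathcomp Require Import all_boot all_order all_algebra.
From mathcomp Require Import all_classical all_reals all_analysis.
From mathcomp Require Export complex.
Import Order.TTheory GRing.Theory Num.Theory.
Import numFieldNormedType.Exports.

Set Implicit Arguments.
Unset Strict Implicit.
Unset Printing Implicit Defensive.

Local Open Scope classical_set_scope.
Local Open Scope ring_scope.

(* The library norm on 'rV[R]_n is the sup norm; it induces the same topology
   as the Euclidean norm below. *)
Definition enorm (R : realType) (n : nat) (t : 'rV[R]_n) : R :=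
  Num.sqrt (\sum_(i < n) t 0 i ^+ 2).

Definition eball (R : realType) (n : nat) (t0 : 'rV[R]_n) (r : R) :
    set 'rV[R]_n :=
  [set t | enorm (t - t0) <= r].

(* The norm of a normed space over R[i] takes its values in R[i], where it is a
   nonnegative real; [rnorm] is the same number seen in R. *)
Definition rnorm (R : realType) (Y : normedModType R[i]) (y : Y) : R :=
  complex.Re `|y|.

Definition set_add (V : zmodType) (A B : set V) : set V :=
  [set s + t | s in A & t in B].

Definition set_mulrn (V : zmodType) (l : nat) (A : set V) : set V :=
  [set t *+ l | t in A].

Section almost_periodicity.
Context (R : realType) (n : nat) (X Y : normedModType R[i]).
Implicit Types (I J : set 'rV[R]_n) (BB : set (set X)) (d : R[i]).

(* A function I * X -> Y is encoded by a total function F whose values outside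
   I are irrelevant: below, F is evaluated only on I when I + J is contained
   in I. *)
Definition continuous_on_I I (F : 'rV[R]_n -> X -> Y) : Prop :=
  {within I `*` [set: X], continuous (fun p : 'rV[R]_n * X => F p.1 p.2)}.

Definition bohr_almost_periodic I BB J d (F : 'rV[R]_n -> X -> Y) : Prop :=
  continuous_on_I I F /\
  forall B, BB B -> forall eps : R, 0 < eps ->
    exists2 r : R, 0 < r &
      forall t0, J t0 ->
        exists2 tau, (eball t0 r `&` J) tau &
          forall t x, I t -> B x -> rnorm (F (t + tau) x - d *: F t x) <= eps.

(* The supremum is taken in the extended reals, as it may be infinite for some
   indices k. *)
Definition uniformly_recurrent I BB J d (F : 'rV[R]_n -> X -> Y) : Prop :=
  continuous_on_I I F /\
  forall B, BB B ->
    exists tau : nat -> 'rV[R]_n,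
      [/\ forall k, J (tau k),
          enorm (tau k) @[k --> \oo] --> +oo%R &
          ereal_sup [set (rnorm (F (t + tau k) x - d *: F t x))%:E
                    | t in I & x in B] @[k --> \oo] --> 0%E].

End almost_periodicity.

(* Main.v *)
Require Import Defs.
From mathcomp Require Import all_boot all_order all_algebra.
From mathcomp Require Import all_classical all_reals all_analysis.
Import Order.TTheory GRing.Theory Num.Theory.
Import numFieldNormedType.Exports.

Set Implicit Arguments.
Unset Strict Implicit.
Unset Printing Implicit Defensive.

Local Open Scope classical_set_scope.
Local Open Scope ring_scope.

(** Suppose that translating by [s] multiplies a function by [d] up to an error [e], uniformly on a
    set stable under [s]. Iterating [l] times, translating by [s *+ l] multiplies it by [d ^+ l] up
    to K e, where K = 1 + |d| + ... + |d|^(l-1) ([rnorm_translateMn]). K depends only on [d] and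
    [l], so uniformity in [t] and [x] survives. In the Bohr case, start from the error eps / K and
    scale the radius by [l]; for recurrence, replace tau_k by l tau_k and squeeze the new suprema
    between 0 and K times the old ones. *)

Section rnorm.
Context {R : realType} {Y : normedModType R[i]}.
Implicit Types (y z : Y) (d : R[i]).

Lemma rnormE y : (rnorm y)%:C%C = `|y|.
Proof. by rewrite /rnorm RRe_real// normr_real. Qed.

Lemma rnorm_ge0 y : 0 <= rnorm y.
Proof. by rewrite -ler0c rnormE. Qed.

Lemma ler_rnormD y z : rnorm (y + z) <= rnorm y + rnorm z.
Proof. by rewrite -lecR rmorphD /= !rnormE ler_normD. Qed.

Lemma rnormZ d y : rnorm (d *: y) = complex.Re `|d| * rnorm y.
Proof.
by apply: complexI; rewrite rmorphM /= (RRe_real (normr_real _)) !rnormE normrZ.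
Qed.

End rnorm.

Lemma Re_norm_ge0 {R : realType} (d : R[i]) : 0 <= complex.Re `|d|.
Proof. by rewrite -ler0c RRe_real ?normr_real. Qed.

Lemma enormMn {R : realType} {n : nat} (t : 'rV[R]_n) (l : nat) :
  enorm (t *+ l) = enorm t * l%:R.
Proof.
rewrite /enorm; under eq_bigr do rewrite mulmxnE -mulr_natr exprMn.
rewrite -mulr_suml sqrtrM ?sqrtr_sqr ?ger0_norm//.
by apply: sumr_ge0 => i _; exact: sqr_ge0.
Qed.

Lemma set_add_mulrn (V : zmodType) (I J : set V) (l : nat) :
  set_add I J `<=` I -> set_add I (set_mulrn l J) `<=` I.
Proof.
move=> IJ _ [t It [_ [s Js <-] <-]].
elim: l => [|l IHl]; first by rewrite mulr0n addr0.
by rewrite mulrSr addrA; apply: IJ; exists (t + s *+ l) => //; exists s.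
Qed.

(** Write l s = s + (l - 1) s, where the first [s] lies in [I] because [J] does. For l = 0 this
    fails, as 0 need not belong to [I]. *)
Lemma set_mulrn_sub (V : zmodType) (I J : set V) (l : nat) : (0 < l)%N ->
  J `<=` I -> set_add I J `<=` I -> set_mulrn l J `<=` I.
Proof.
case: l => // l _ JI IJ _ [s Js <-]; rewrite mulrS.
by apply: (set_add_mulrn IJ); exists s; [exact: JI|exists (s *+ l) => //; exists s].
Qed.

(** Factor by which the error grows from a translation to its [l]-fold iterate. *)
Definition geom_sum {R : realType} (d : R[i]) (l : nat) : R :=
  \sum_(j < l) complex.Re `|d| ^+ j.

Lemma geom_sum_gt0 {R : realType} (d : R[i]) (l : nat) :
  (0 < l)%N -> 0 < geom_sum d l.
Proof.
case: l => // l _; rewrite /geom_sum big_ord_recl expr0 ltr_pwDl//.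
by apply: sumr_ge0 => j _; rewrite exprn_ge0// Re_norm_ge0.
Qed.

Section translates.
Context {R : realType} {V : zmodType} {Y : normedModType R[i]}.

(* Telescoping: f(t + (l+1)s) - d^(l+1) f(t)
   = [f(t + ls + s) - d f(t + ls)] + d [f(t + ls) - d^l f(t)]. *)
Lemma rnorm_translateMn (I : set V) (f : V -> Y) (d : R[i]) (s : V) (e : R) :
  (forall t, I t -> I (t + s)) ->
  (forall t, I t -> rnorm (f (t + s) - d *: f t) <= e) ->
  forall (l : nat) t, I t ->
    rnorm (f (t + s *+ l) - d ^+ l *: f t) <= geom_sum d l * e.
Proof.
move=> Is fs l t It; have Isl k : I (t + s *+ k).
  by elim: k => [|k IHk]; rewrite ?mulr0n ?addr0// mulrSr addrA; exact: Is.
elim: l => [|l IHl].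
  rewrite mulr0n addr0 expr0 scale1r subrr /geom_sum big_ord0 mul0r.
  by rewrite /rnorm normr0.
rewrite mulrSr addrA exprS -scalerA.
rewrite -(subrKA (d *: f (t + s *+ l))) -scalerBr.
(* With K_l for [geom_sum d l], K_(l+1) = 1 + |d| K_l: the first bracket costs [e], the second |d|
   K_l e. *)
apply: (le_trans (ler_rnormD _ _)); rewrite rnormZ /geom_sum big_ord_recl expr0.
rewrite mulrDl mul1r lerD ?fs//.
under eq_bigr do rewrite exprS.
by rewrite -mulr_sumr -mulrA ler_wpM2l// Re_norm_ge0.
Qed.

End translates.

Section multiples.
Context {R : realType} {n : nat} {X Y : normedModType R[i]}.
Variables (I J : set 'rV[R]_n) (BB : set (set X)) (d : R[i]) (l : nat).
Variable F : 'rV[R]_n -> X -> Y.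
Hypotheses (l0 : (0 < l)%N) (IJ : set_add I J `<=` I).

Lemma bohr_almost_periodic_mulrn : bohr_almost_periodic I BB J d F ->
  bohr_almost_periodic I BB (set_mulrn l J) (d ^+ l) F.
Proof.
move=> [cF H]; split=> // B BBB e e0; have K0 := geom_sum_gt0 d l0.
have [r r0 Hr] := H B BBB _ (divr_gt0 e0 K0).
(* Multiplication by [l] scales Euclidean distances by [l]. *)
exists (r * l%:R); first by rewrite mulr_gt0// ltr0n.
move=> _ [s Js <-]; have [tau [rtau Jtau] Htau] := Hr s Js.
exists (tau *+ l); first split.
- by rewrite /eball /= -mulrnBl enormMn ler_wpM2r.
- by exists tau.
move=> t x It Bx.
have -> : e = geom_sum d l * (e / geom_sum d l) by rewrite mulrC divfK// gt_eqF.
apply: (rnorm_translateMn (f := F^~ x) (I := I)) => // u Iu.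
  by apply: IJ; exists u => //; exists tau.
exact: Htau.
Qed.

(** Non-emptiness of [I] and of each [B] keeps the suprema nonnegative: over an empty set they would
    be -oo and could not tend to 0. *)
Lemma uniformly_recurrent_mulrn : I !=set0 -> (forall B, BB B -> B !=set0) ->
  uniformly_recurrent I BB J d F ->
  uniformly_recurrent I BB (set_mulrn l J) (d ^+ l) F.
Proof.
move=> [t0 It0] BB0 [cF H]; split=> // B BBB; have K0 := geom_sum_gt0 d l0.
have [x0 Bx0] := BB0 B BBB; have [tau [Jtau tauoo Htau]] := H B BBB.
exists (fun k => tau k *+ l); split.
- by move=> k; exists (tau k).
- under eq_fun do rewrite enormMn.
  move/cvgryPge: tauoo => tauoo; apply/cvgryPge => A.
  by apply: filterS (tauoo (A / l%:R)) => k; rewrite ler_pdivrMr ?ltr0n.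
pose S k := ereal_sup [set (rnorm (F (t + tau k) x - d *: F t x))%:E
                      | t in I & x in B].
have S_ub k t x : I t -> B x ->
    ((rnorm (F (t + tau k) x - d *: F t x))%:E <= S k)%E.
  by move=> It Bx; apply: ereal_sup_ubound; exists t => //; exists x.
apply: (squeeze_cvge (f := cst 0%E) (h := fun k => (geom_sum d l)%:E * S k)%E).
- near=> k; apply/andP; split.
    apply: le_trans (ereal_sup_ubound _); last by exists t0 => //; exists x0.
    by rewrite lee_fin rnorm_ge0.
  apply: ge_ereal_sup => _ [t It [x Bx <-]].
  (* A finite supremum is itself a uniform error. If it is +oo, so is the bound, because K > 0; -oo
     is excluded by the element at hand. *)
  case E: (S k) => [e| |].
  + rewrite -EFinM lee_fin.
    apply: (rnorm_translateMn (f := F^~ x) (I := I)) => // u Iu.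
      by apply: IJ; exists u => //; exists (tau k).
    by rewrite -lee_fin -E S_ub.
  + by rewrite gt0_muley ?lte_fin// leey.
  + by have := S_ub k t x It Bx; rewrite E.
- exact: cvg_cst.
- by rewrite -(mule0 (geom_sum d l)%:E); exact: cvgeZl.
Unshelve. all: by end_near.
Qed.

End multiples.

Theorem proposition2p13 (R : realType) (n : nat) (hn : (0 < n)%N)
  (X Y : completeNormedModType R[i]) (c : R[i]) (hc : c != 0)
  (BB : set (set X)) (hBB : BB !=set0)
  (hBB0 : forall B : set X, BB B -> B !=set0)
  (hBBcover : forall x : X, exists2 B : set X, BB B & B x)
  (l : nat) (hl : (0 < l)%N)
  (I I' : set 'rV[R]_n) (hI'0 : I' !=set0) (hI'I : I' `<=` I)
  (hII' : set_add I I' `<=` I)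
  (F : 'rV[R]_n -> X -> Y) :
  (bohr_almost_periodic I BB I' c F ->
     [/\ set_mulrn l I' `<=` I,
         set_add I (set_mulrn l I') `<=` I &
         bohr_almost_periodic I BB (set_mulrn l I') (c ^+ l) F]) /\
  (uniformly_recurrent I BB I' c F ->
     [/\ set_mulrn l I' `<=` I,
         set_add I (set_mulrn l I') `<=` I &
         uniformly_recurrent I BB (set_mulrn l I') (c ^+ l) F]).
Proof.
have lI'I := set_mulrn_sub hl hI'I hII'; have IlI' := set_add_mulrn (l := l) hII'.
split=> HF; split=> //; first exact: bohr_almost_periodic_mulrn.
apply: uniformly_recurrent_mulrn => //.
by have [s /hI'I Is] := hI'0; exists s.
Qed.
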